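(* For every real $\nu>-1$ and every $\tau\in(0,1/2]$, the function $x\mapsto W_\nu(x^\tau)$ is a Bernstein function on $(0,\infty)$, where $W_\nu(z)=\dfrac{zI_\nu(z)}{I_{\nu+1}(z)}$ for $z>0$.
   Context: $I_\mu$ is the modified Bessel function of the first kind of order $\mu>-1$: for $z>0$, $I_\mu(z)=\sum_{k\ge0}\frac{(z/2)^{2k+\mu}}{k!\,\Gamma(k+\mu+1)}$. A function $f:(0,\infty)\to[0,\infty)$ is completely monotone if $f\in C^\infty$ and $(-1)^nf^{(n)}(x)\ge0$ for all integers $n\ge0$ and all $x>0$. A function $g:(0,\infty)\to[0,\infty)$ is a Bernstein function if $g\in C^\infty$ and $g'$ is completely monotone. *)

(* Defs.v *)
From Stdlib Require Import Reals Factorial.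
From Coquelicot Require Import Coquelicot.
Open Scope R_scope.

(* Euler's integral; it converges, and hence is the Gamma function, for 0 < s. *)
Definition Gamma (s : R) : R :=
  RInt_gen (fun t : R => Rpower t (s - 1) * exp (- t))
           (at_right 0) (Rbar_locally p_infty).

(* Meaningful for -1 < mu and 0 < z, where the series converges. *)
Definition BesselI (mu z : R) : R :=
  Series (fun k : nat =>
    Rpower (z / 2) (2 * INR k + mu) / (INR (fact k) * Gamma (INR k + mu + 1))).

Definition W (nu z : R) : R := z * BesselI nu z / BesselI (nu + 1) z.

(* A function on (0, +oo) is represented by a total function on R, whose values
   outside (0, +oo) are irrelevant to the predicates below. *)
Definition smooth_pos (f : R -> R) : Prop :=
  forall (n : nat) (x : R), 0 < x -> ex_derive_n f n x.

Definition completely_monotone (f : R -> R) : Prop :=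
  smooth_pos f /\
  forall (n : nat) (x : R), 0 < x -> 0 <= (-1) ^ n * Derive_n f n x.

Definition bernstein (g : R -> R) : Prop :=
  (forall x : R, 0 < x -> 0 <= g x) /\
  smooth_pos g /\
  completely_monotone (Derive g).

(* Main.v *)
Require Import Defs.
From Stdlib Require Import Reals Factorial Lra Lia.
From Coquelicot Require Import Coquelicot.
Open Scope R_scope.

(** Put [y = z ^ 2 / 4].  Then [W nu z = 2 * u y], where [u] is the quotient
    [E nu / E (nu + 1)] of the entire series
    [E mu y = sum_k y ^ k / (k! Gamma (k + mu + 1))] ([bessel_series],
    [bessel_ratio], [W_eq_ratio]).  The point of this variable is that [u] is
    smooth across [y = 0].  Since [Gamma (s + 1) = s * Gamma s], the series
    satisfy [E mu' = E (mu + 1)] and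
    [E mu = (mu + 1) * E (mu + 1) + y * E (mu + 2)].  Hence, with [m = nu + 1],
    [u >= m > 0] on [y >= 0], and [u] solves the Riccati equation
    [y u' = m u + y - u ^ 2].

    This equation, the bound [u >= m] and the smoothness at [0] force [u'] to be
    completely monotone ([riccati_derivative_signs]); the zeros of the Bessel
    functions do not enter.  Differentiating it [n + 1] times, [v = u^(n + 1)] solves
    a linear equation
    [y v' = (m - 1 - n - 2 u) v + S_n],
    where [S_n] only involves [u', ..., u^(n)].  When these have alternating
    signs, every term of [S_n] has the sign [(-1) ^ n].  The coefficient of
    [v] is at most [- m - 1 - n < 0], so if [Z = (-1) ^ n * v] were negative
    somewhere, then at a negative minimum of [Z] over a segment starting at [0]
    the equation would give [y Z' > 0]: impossible at [y = 0], and, to the right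
    of [0], incompatible with minimality.  Thus [Z >= 0], and induction on [n] concludes.

    Finally [W nu (x ^ tau) = 2 * u (x ^ (2 tau) / 4)].  As [2 tau <= 1], the
    derivative of [x ^ (2 tau)] is completely monotone, and complete monotonicity
    passes through the chain rule and through products. *)

(** * The Gamma integral *)

Lemma is_derive_Rpower (p x : R) :
  0 < x -> is_derive (fun t => Rpower t p) x (p * Rpower x (p - 1)).
Proof. intros hx. apply is_derive_Reals. now apply derivable_pt_lim_power. Qed.

Lemma Rpower_pos (x p : R) : 0 < Rpower x p.
Proof. apply exp_pos. Qed.

Lemma at_right_0_pos : at_right 0 (fun a => 0 < a).
Proof. exists (mkposreal 1 Rlt_0_1). intros a _ ha; exact ha. Qed.

(** A positive integrand has integrals that grow with the interval, so a uniform
    bound makes them converge to their supremum.  Strict positivity of the limit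
    is what allows dividing by Gamma values later. *)
Lemma is_RInt_gen_pos_bounded (f : R -> R) (M : R) :
  (forall t, 0 < t -> continuous f t) ->
  (forall t, 0 < t -> 0 < f t) ->
  (forall a b, 0 < a <= b -> RInt f a b <= M) ->
  exists l, 0 < l /\ is_RInt_gen f (at_right 0) (Rbar_locally p_infty) l.
Proof.
  intros hc hp hM.
  assert (hex : forall a b, 0 < a <= b -> ex_RInt f a b).
  { intros a b hab. apply (ex_RInt_continuous (V := R_CompleteNormedModule)). intros z hz.
    apply hc. rewrite Rmin_left in hz by lra. lra. }
  assert (hge : forall a b, 0 < a <= b -> 0 <= RInt f a b).
  { intros a b hab. apply RInt_ge_0; [lra | now apply hex |].
    intros x hx; apply Rlt_le, hp; lra. }
  set (E := fun v => exists a b, 0 < a <= b /\ v = RInt f a b).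
  destruct (completeness E) as [l [hub hlub]].
  - exists M. intros v [a [b [hab ->]]]. now apply hM.
  - exists (RInt f 1 2), 1, 2. split; [lra | reflexivity].
  - exists l. split.
    + apply Rlt_le_trans with (RInt f 1 2).
      * apply RInt_gt_0; [lra | |]; intros x hx; [apply hp | apply hc]; lra.
      * apply hub. exists 1, 2. split; [lra | reflexivity].
    + unfold is_RInt_gen. apply filterlimi_locally. intros eps.
      assert (hnear : exists a0 b0, 0 < a0 <= b0 /\ l - eps < RInt f a0 b0).
      { apply Classical_Prop.NNPP. intros hno.
        assert (hle : l <= l - eps).
        { apply hlub. intros v [a [b [hab ->]]].
          apply Rnot_lt_le. intros hlt. apply hno. now exists a, b. }
        destruct eps as [e he]; simpl in *; lra. }
      destruct hnear as [a0 [b0 [hab0 hl]]].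
      assert (ha0 : 0 < a0) by lra.
      apply (Filter_prod _ _ _ (fun a => 0 < a < a0) (fun b => b0 < b)).
      * exists (mkposreal a0 ha0). intros a hball ha. simpl in hball.
        unfold ball in hball; simpl in hball.
        unfold AbsRing_ball, abs, minus, plus, opp in hball; simpl in hball.
        apply Rabs_def2 in hball. lra.
      * now exists b0.
      * intros a b ha hb. simpl. exists (RInt f a b). split.
        { apply (RInt_correct f). apply hex. lra. }
        assert (h1 : RInt f a b = RInt f a a0 + (RInt f a0 b0 + RInt f b0 b)).
        { pose proof (RInt_Chasles f a a0 b (hex a a0 ltac:(lra)) (hex a0 b ltac:(lra))) as e1.
          pose proof (RInt_Chasles f a0 b0 b (hex a0 b0 ltac:(lra)) (hex b0 b ltac:(lra))) as e2.
          unfold plus in e1, e2; simpl in e1, e2. lra. }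
        pose proof (hge a a0 ltac:(lra)). pose proof (hge b0 b ltac:(lra)).
        assert (RInt f a b <= l).
        { apply hub. exists a, b. split; [lra | reflexivity]. }
        unfold ball; simpl. unfold AbsRing_ball, abs, minus, plus, opp; simpl.
        apply Rabs_def1; lra.
Qed.

Definition gamma_integrand (s t : R) : R := Rpower t (s - 1) * exp (- t).

Lemma gamma_integrand_continuous (s t : R) :
  0 < t -> continuous (gamma_integrand s) t.
Proof.
  intros ht. apply (ex_derive_continuous (gamma_integrand s)).
  exists ((s - 1) * Rpower t (s - 1 - 1) * exp (- t) + Rpower t (s - 1) * (- 1 * exp (- t))).
  unfold gamma_integrand. apply (is_derive_mult (fun u => Rpower u (s - 1)) (fun u => exp (- u))).
  - now apply is_derive_Rpower.
  - auto_derive; [exact I | ring].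
  - intros; apply Rmult_comm.
Qed.

(** From [ln q <= q - 1] at [q = (1 + t) / p]; this gives the constant
    [exp (1 + p * ln p - p)]. *)
Lemma Rpower_exp_bounded (p : R) :
  0 < p -> exists K, 0 < K /\ forall t, 0 < t -> Rpower (1 + t) p * exp (- t) <= K.
Proof.
  intros hp. exists (exp (1 + p * ln p - p)). split; [apply exp_pos |].
  intros t ht. unfold Rpower. rewrite <- exp_plus.
  assert (hln : ln (1 + t) <= (1 + t) / p + ln p - 1).
  { pose proof (exp_ineq1_le (ln ((1 + t) / p))) as h.
    assert (hq : 0 < (1 + t) / p) by (apply Rdiv_lt_0_compat; lra).
    rewrite exp_ln in h by exact hq.
    rewrite ln_div in h by lra. lra. }
  apply Rmult_le_compat_l with (r := p) in hln; [| lra].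
  replace (p * ((1 + t) / p + ln p - 1)) with (1 + t + p * ln p - p) in hln by (field; lra).
  destruct (Rle_lt_or_eq_dec (p * ln (1 + t) + - t) (1 + p * ln p - p) ltac:(lra)) as [h | ->].
  - apply Rlt_le. now apply exp_increasing.
  - apply Rle_refl.
Qed.

(** The exponential is at most [K / (1 + t) ^ (s + 1)], and the resulting majorant
    [K * t ^ (s - 1) / (1 + t) ^ (s + 1)] has the bounded primitive
    [K / s * (t / (1 + t)) ^ s].  One majorant thus covers both endpoints. *)
Lemma gamma_integrand_bounded (s : R) :
  0 < s -> exists M, forall a b, 0 < a <= b -> RInt (gamma_integrand s) a b <= M.
Proof.
  intros hs. destruct (Rpower_exp_bounded (s + 1) ltac:(lra)) as [K [hK hbound]].
  exists (K / s). intros a b hab.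
  set (G := fun t => K / s * Rpower (t / (1 + t)) s).
  set (g := fun t => K * (Rpower (t / (1 + t)) (s - 1) * / (1 + t) ^ 2)).
  assert (hdG : forall t, 0 < t -> is_derive G t (g t)).
  { intros t ht. unfold G, g.
    assert (hq : 0 < t / (1 + t)) by (apply Rdiv_lt_0_compat; lra).
    assert (h := is_derive_comp (fun u => Rpower u s) (fun u => u / (1 + u)) t _ (/ (1 + t) ^ 2)
      (is_derive_Rpower s _ hq)).
    assert (hd : is_derive (fun u => u / (1 + u)) t (/ (1 + t) ^ 2)).
    { auto_derive; [lra | field; lra]. }
    specialize (h hd).
    apply (is_derive_scal _ t (K / s)) in h.
    unfold scal in h; simpl in h; unfold mult in h; simpl in h.
    eapply is_derive_ext; [| replace (K * _) with
      (K / s * (/ ((1 + t) * ((1 + t) * 1)) * (s * Rpower (t / (1 + t)) (s - 1))));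
      [exact h | simpl; field; lra]].
    reflexivity. }
  assert (hcg : forall t, 0 < t -> continuous g t).
  { intros t ht. apply (ex_derive_continuous g). unfold g.
    assert (hq : 0 < t / (1 + t)) by (apply Rdiv_lt_0_compat; lra).
    apply ex_derive_scal, ex_derive_mult.
    - apply (ex_derive_comp (fun u => Rpower u (s - 1)) (fun u => u / (1 + u))).
      + eexists; now apply is_derive_Rpower.
      + auto_derive; lra.
    - auto_derive. pose proof (Rmult_lt_0_compat (1 + t) (1 + t) ltac:(lra) ltac:(lra)). lra. }
  assert (hI : is_RInt g a b (G b - G a)).
  { apply (is_RInt_derive G g); intros x hx; rewrite Rmin_left in hx by lra;
      [apply hdG | apply hcg]; lra. }
  apply Rle_trans with (RInt g a b).
  - apply RInt_le; [lra | | now exists (G b - G a) |].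
    + apply (ex_RInt_continuous (V := R_CompleteNormedModule)). intros z hz. rewrite Rmin_left in hz by lra.
      apply gamma_integrand_continuous; lra.
    + intros t ht. unfold gamma_integrand, g.
      assert (e1 : Rpower t (s - 1) = Rpower (t / (1 + t)) (s - 1) * Rpower (1 + t) (s - 1)).
      { rewrite Rpower_mult_distr; [f_equal; field; lra | | lra].
        apply Rdiv_lt_0_compat; lra. }
      assert (e2 : Rpower (1 + t) (s + 1) = Rpower (1 + t) (s - 1) * (1 + t) ^ 2).
      { replace (s + 1) with (s - 1 + INR 2) by (simpl; ring).
        rewrite Rpower_plus, Rpower_pow by lra. reflexivity. }
      pose proof (hbound t ltac:(lra)) as hb. rewrite e2 in hb. rewrite e1.
      assert (hsq : 0 < (1 + t) ^ 2) by (apply pow_lt; lra).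
      pose proof (Rpower_pos (t / (1 + t)) (s - 1)) as hP.
      replace (Rpower (t / (1 + t)) (s - 1) * Rpower (1 + t) (s - 1) * exp (- t)) with
        (Rpower (t / (1 + t)) (s - 1) * / (1 + t) ^ 2 *
          (Rpower (1 + t) (s - 1) * (1 + t) ^ 2 * exp (- t))) by (field; lra).
      rewrite (Rmult_comm K). apply Rmult_le_compat_l; [| exact hb].
      apply Rlt_le, Rmult_lt_0_compat; [exact hP | now apply Rinv_0_lt_compat].
  - rewrite (is_RInt_unique _ _ _ _ hI).
    assert (hKs : 0 < K / s) by (apply Rdiv_lt_0_compat; lra).
    assert (hGa : 0 < G a) by (apply Rmult_lt_0_compat; [exact hKs | apply Rpower_pos]).
    assert (hGb : G b <= K / s).
    { unfold G. rewrite <- (Rmult_1_r (K / s)) at 2. apply Rmult_le_compat_l; [lra |].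
      assert (hb : b / (1 + b) <= 1).
      { apply Rmult_le_reg_r with (1 + b); [lra |].
        unfold Rdiv. rewrite Rmult_assoc, Rinv_l; lra. }
      apply Rle_trans with (Rpower 1 s);
        [| unfold Rpower; rewrite ln_1, Rmult_0_r, exp_0; lra].
      apply Rle_Rpower_l; [lra |]. split; [apply Rdiv_lt_0_compat; lra | exact hb]. }
    lra.
Qed.

Lemma Gamma_spec (s : R) : 0 < s ->
  0 < Gamma s /\ is_RInt_gen (gamma_integrand s) (at_right 0) (Rbar_locally p_infty) (Gamma s).
Proof.
  intros hs. destruct (gamma_integrand_bounded s hs) as [M hM].
  destruct (is_RInt_gen_pos_bounded (gamma_integrand s) M) as [l [hl hI]].
  - intros t ht. now apply gamma_integrand_continuous.
  - intros t ht. apply Rmult_lt_0_compat; apply exp_pos.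
  - exact hM.
  - assert (e : Gamma s = l) by exact (is_RInt_gen_unique _ _ hI).
    rewrite e. now split.
Qed.

Lemma Gamma_pos (s : R) : 0 < s -> 0 < Gamma s.
Proof. intros hs. now apply Gamma_spec. Qed.

(** Integration by parts: [t ^ s * exp (- t)] vanishes at both ends of
    [(0, +oo)], so the integral of its derivative is [0]. *)
Lemma Gamma_succ (s : R) : 0 < s -> Gamma (s + 1) = s * Gamma s.
Proof.
  intros hs.
  set (h := fun t => Rpower t s * exp (- t)).
  set (g := fun t => s * gamma_integrand s t - gamma_integrand (s + 1) t).
  assert (hd : forall t, 0 < t -> is_derive h t (g t)).
  { intros t ht. unfold h, g, gamma_integrand. replace (s + 1 - 1) with s by ring.
    replace (s * (Rpower t (s - 1) * exp (- t)) - Rpower t s * exp (- t)) with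
      (s * Rpower t (s - 1) * exp (- t) + Rpower t s * (- 1 * exp (- t))) by ring.
    apply (is_derive_mult (fun u => Rpower u s) (fun u => exp (- u))).
    - now apply is_derive_Rpower.
    - auto_derive; [exact I | ring].
    - intros; apply Rmult_comm. }
  assert (hprod : forall P : R -> Prop, (forall t, 0 < t -> P t) ->
    filter_prod (at_right 0) (Rbar_locally p_infty)
      (fun ab : R * R => forall x, Rmin (fst ab) (snd ab) <= x <= Rmax (fst ab) (snd ab) -> P x)).
  { intros P hP. apply (Filter_prod _ _ _ (fun a => 0 < a) (fun b => 0 < b)).
    - apply at_right_0_pos.
    - now exists 0.
    - intros a b ha hb x hx. simpl in hx. apply hP.
      pose proof (Rmin_glb_lt a b 0 ha hb). lra. }
  assert (hD : is_RInt_gen (Derive h) (at_right 0) (Rbar_locally p_infty) (0 - 0)).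
  { apply is_RInt_gen_Derive.
    - apply hprod. intros t ht. exists (g t). now apply hd.
    - apply hprod. intros t ht.
      apply (continuous_ext_loc (U := R_UniformSpace) (Derive h) g).
      + exists (mkposreal t ht). intros u hu. unfold ball in hu; simpl in hu.
        unfold AbsRing_ball, abs, minus, plus, opp in hu; simpl in hu.
        apply Rabs_def2 in hu. symmetry. apply is_derive_unique, hd. lra.
      + apply (continuous_minus (fun t => s * gamma_integrand s t) (gamma_integrand (s + 1))).
        * apply (continuous_scal_r s (gamma_integrand s)).
          now apply gamma_integrand_continuous.
        * now apply gamma_integrand_continuous.
    (* At 0, [t ^ s * exp (- t) <= t ^ s]. *)
    - apply filterlim_locally. intros eps.
      assert (hr : 0 < Rpower eps (/ s)) by apply Rpower_pos.
      exists (mkposreal _ hr). intros t ht htp.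
      unfold ball in *; simpl in *. unfold AbsRing_ball, abs, minus, plus, opp in *; simpl in *.
      apply Rabs_def2 in ht. unfold h.
      assert (h1 : exp (- t) < 1) by (rewrite <- exp_0; apply exp_increasing; lra).
      pose proof (exp_pos (- t)) as h0. pose proof (Rpower_pos t s) as hP.
      assert (h2 : Rpower t s < eps).
      { replace (pos eps) with (Rpower (Rpower eps (/ s)) s).
        - apply Rlt_Rpower_l; lra.
        - rewrite Rpower_mult, Rinv_l by lra. apply Rpower_1, cond_pos. }
      rewrite Ropp_0, Rplus_0_r, Rabs_right.
      + apply Rle_lt_trans with (Rpower t s * 1); [apply Rmult_le_compat_l |]; lra.
      + apply Rle_ge, Rlt_le, Rmult_lt_0_compat; assumption.
    (* At infinity, [t ^ s * exp (- t) <= K / (1 + t)]. *)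
    - destruct (Rpower_exp_bounded (s + 1) ltac:(lra)) as [K [hK hbound]].
      apply filterlim_locally. intros eps.
      pose proof (cond_pos eps) as heps.
      exists (K / eps). intros t ht.
      assert (hq : 0 < K / eps) by (apply Rdiv_lt_0_compat; lra).
      unfold ball; simpl. unfold AbsRing_ball, abs, minus, plus, opp; simpl. unfold h.
      pose proof (exp_pos (- t)) as h0. pose proof (Rpower_pos t s) as hP.
      specialize (hbound t ltac:(lra)).
      rewrite Rpower_plus, Rpower_1 in hbound by lra.
      assert (hle : Rpower t s <= Rpower (1 + t) s) by (apply Rle_Rpower_l; lra).
      rewrite Ropp_0, Rplus_0_r, Rabs_right
        by (apply Rle_ge, Rlt_le, Rmult_lt_0_compat; assumption).
      assert (hKt : K < eps * t).
      { replace K with (eps * (K / eps)) by (field; lra). apply Rmult_lt_compat_l; lra. }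
      assert (h3 : Rpower t s * exp (- t) * (1 + t) <= K).
      { apply Rle_trans with (2 := hbound).
        replace (Rpower (1 + t) s * (1 + t) * exp (- t)) with
          (Rpower (1 + t) s * (exp (- t) * (1 + t))) by ring.
        rewrite Rmult_assoc. apply Rmult_le_compat_r; [| exact hle].
        apply Rmult_le_pos; lra. }
      apply Rmult_lt_reg_r with (1 + t); [lra |].
      apply Rle_lt_trans with (1 := h3). lra. }
  destruct (Gamma_spec s hs) as [_ h1]. destruct (Gamma_spec (s + 1) ltac:(lra)) as [_ h2].
  pose proof (is_RInt_gen_minus _ _ _ _ (is_RInt_gen_scal _ s _ h1) h2) as h3.
  assert (hD' : is_RInt_gen g (at_right 0) (Rbar_locally p_infty) (0 - 0)).
  { apply (is_RInt_gen_ext (Derive h)); [| exact hD].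
    eapply filter_imp; [| apply (hprod (fun t => Derive h t = g t))].
    - intros ab hab x hx. apply hab. lra.
    - intros t ht. now apply is_derive_unique, hd. }
  assert (e1 := is_RInt_gen_unique _ _ hD').
  assert (e2 : RInt_gen g (at_right 0) (Rbar_locally p_infty) = s * Gamma s - Gamma (s + 1)).
  { exact (is_RInt_gen_unique _ _ h3). }
  lra.
Qed.

(** * The power series of the Bessel functions *)

Definition bessel_coef (mu : R) (k : nat) : R := / (INR (fact k) * Gamma (INR k + mu + 1)).

(** The entire function [E mu] with [I_mu z = (z / 2) ^ mu * E mu (z ^ 2 / 4)]. *)
Definition bessel_series (mu y : R) : R := PSeries (bessel_coef mu) y.

Lemma bessel_coef_pos (mu : R) (k : nat) : -1 < mu -> 0 < bessel_coef mu k.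
Proof.
  intros hmu. pose proof (pos_INR k). apply Rinv_0_lt_compat, Rmult_lt_0_compat.
  - apply INR_fact_lt_0.
  - apply Gamma_pos. lra.
Qed.

Lemma bessel_coef_order (mu : R) (k : nat) :
  -1 < mu -> bessel_coef mu k = (INR k + mu + 1) * bessel_coef (mu + 1) k.
Proof.
  intros hmu. pose proof (pos_INR k). unfold bessel_coef.
  replace (INR k + (mu + 1) + 1) with (INR k + mu + 1 + 1) by ring.
  rewrite (Gamma_succ (INR k + mu + 1)) by lra.
  pose proof (Gamma_pos (INR k + mu + 1) ltac:(lra)). pose proof (INR_fact_lt_0 k).
  field. repeat split; lra.
Qed.

Lemma bessel_coef_derive (mu : R) (k : nat) :
  PS_derive (bessel_coef mu) k = bessel_coef (mu + 1) k.
Proof.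
  unfold PS_derive, bessel_coef. rewrite fact_simpl, mult_INR.
  replace (INR (S k) + mu + 1) with (INR k + (mu + 1) + 1) by (rewrite S_INR; ring).
  rewrite !Rinv_mult, <- !Rmult_assoc, Rinv_r by (apply not_0_INR; discriminate).
  ring.
Qed.

Lemma bessel_coef_CV_radius (mu : R) : -1 < mu -> CV_radius (bessel_coef mu) = p_infty.
Proof.
  intros hmu. apply CV_radius_infinite_DAlembert.
  - intros k. pose proof (bessel_coef_pos mu k hmu). lra.
  - apply is_lim_seq_le_le with (fun _ => 0) (fun k => / (mu + 1) * / INR (S k)).
    + intros k. pose proof (bessel_coef_pos mu k hmu) as h0.
      pose proof (bessel_coef_pos mu (S k) hmu) as h1.
      pose proof (bessel_coef_pos (mu + 1) k ltac:(lra)) as h2.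
      pose proof (bessel_coef_order mu k hmu) as e1.
      pose proof (bessel_coef_derive mu k) as e2. unfold PS_derive in e2.
      pose proof (pos_INR k) as hk. pose proof (lt_0_INR (S k) ltac:(lia)) as hSk.
      rewrite Rabs_right by (apply Rle_ge, Rlt_le, Rdiv_lt_0_compat; assumption).
      split; [apply Rlt_le, Rdiv_lt_0_compat; assumption |].
      replace (bessel_coef mu (S k) / bessel_coef mu k) with (/ (INR k + mu + 1) * / INR (S k)).
      * apply Rmult_le_compat_r; [now apply Rlt_le, Rinv_0_lt_compat |].
        apply Rinv_le_contravar; lra.
      * rewrite e1, <- e2. field. repeat split; lra.
    + apply is_lim_seq_const.
    + replace (Finite 0) with (Rbar_mult (/ (mu + 1)) 0) by (simpl; f_equal; ring).
      apply is_lim_seq_scal_l.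
      apply (is_lim_seq_incr_1 (fun k => / INR k)).
      replace (Finite 0) with (Rbar_inv p_infty) by reflexivity.
      apply is_lim_seq_inv; [apply is_lim_seq_INR | discriminate].
Qed.

Lemma bessel_series_inside (mu y : R) :
  -1 < mu -> Rbar_lt (Rabs y) (CV_radius (bessel_coef mu)).
Proof. intros hmu. now rewrite bessel_coef_CV_radius. Qed.

Lemma is_derive_bessel_series (mu y : R) :
  -1 < mu -> is_derive (bessel_series mu) y (bessel_series (mu + 1) y).
Proof.
  intros hmu. unfold bessel_series.
  rewrite <- (PSeries_ext _ _ y (bessel_coef_derive mu)).
  now apply is_derive_PSeries, bessel_series_inside.
Qed.

(** Coefficientwise this is [bessel_coef_order], because the factor [INR k] is the
    action of [y * d/dy]. It is the recurrence
    [I_mu z - I_(mu + 2) z = 2 (mu + 1) / z * I_(mu + 1) z]. *)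
Lemma bessel_series_contiguous (mu y : R) :
  -1 < mu ->
  bessel_series mu y = (mu + 1) * bessel_series (mu + 1) y + y * bessel_series (mu + 1 + 1) y.
Proof.
  intros hmu. unfold bessel_series.
  rewrite <- (PSeries_ext _ _ y (bessel_coef_derive (mu + 1))).
  rewrite <- PSeries_incr_1, <- PSeries_scal, <- PSeries_plus.
  - apply PSeries_ext. intros [| k]; rewrite bessel_coef_order by lra;
      unfold PS_plus, PS_scal, PS_incr_1, PS_derive, plus, scal, mult, zero; simpl; unfold mult; simpl; ring.
  - apply CV_radius_inside. rewrite CV_radius_scal by lra. apply bessel_series_inside; lra.
  - apply ex_pseries_incr_1, ex_pseries_derive, bessel_series_inside. lra.
Qed.

Lemma bessel_series_pos (mu y : R) : -1 < mu -> 0 <= y -> 0 < bessel_series mu y.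
Proof.
  intros hmu hy. unfold bessel_series.
  assert (hex := CV_radius_inside _ _ (bessel_series_inside mu y hmu)).
  rewrite PSeries_decr_1 by exact hex.
  pose proof (bessel_coef_pos mu 0 hmu) as h0.
  assert (h1 : 0 <= PSeries (PS_decr_1 (bessel_coef mu)) y).
  { unfold PSeries. rewrite <- (Rmult_0_l (Series (fun _ => 0))), <- Series_scal_l.
    apply Series_le.
    - intros k. rewrite Rmult_0_l. split; [apply Rle_refl |].
      apply Rmult_le_pos; [| now apply pow_le].
      now apply Rlt_le, bessel_coef_pos.
    - refine (proj1 (ex_pseries_R _ _) _). apply (ex_pseries_decr_1 (V := R_NormedModule)); [| exact hex].
      destruct hy as [hy | <-]; [right | now left].
      exists (/ y). apply Rinv_l. lra. }
  pose proof (Rmult_le_pos _ _ hy h1). lra.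
Qed.

Lemma W_eq_ratio (nu z : R) :
  -1 < nu -> 0 < z -> W nu z = 2 * (bessel_series nu (z ^ 2 / 4) / bessel_series (nu + 1) (z ^ 2 / 4)).
Proof.
  intros hnu hz.
  assert (hI : forall mu, BesselI mu z = Rpower (z / 2) mu * bessel_series mu (z ^ 2 / 4)).
  { intros mu. unfold BesselI, bessel_series, PSeries. rewrite <- Series_scal_l.
    apply Series_ext. intros k. unfold bessel_coef, Rdiv at 1.
    rewrite Rpower_plus, <- Rpower_mult.
    assert (e : Rpower (z / 2) 2 = z ^ 2 / 4).
    { change 2 with (INR 2) at 2. rewrite Rpower_pow by lra. field. }
    pose proof (pow_lt z 2 hz).
    rewrite e, Rpower_pow by lra. ring. }
  unfold W. rewrite !hI, Rpower_plus, Rpower_1 by lra.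
  pose proof (Rpower_pos (z / 2) nu).
  pose proof (pow2_ge_0 z).
  pose proof (bessel_series_pos (nu + 1) (z ^ 2 / 4) ltac:(lra) ltac:(lra)).
  field. repeat split; lra.
Qed.

(** * Derivatives and smoothness on a set *)

Lemma is_derive_eq (f : R -> R) (x a b : R) : is_derive f x a -> a = b -> is_derive f x b.
Proof. now intros h <-. Qed.

Lemma is_derive_Rplus (f g : R -> R) (x a b : R) :
  is_derive f x a -> is_derive g x b -> is_derive (fun t => f t + g t) x (a + b).
Proof. exact (is_derive_plus f g x a b). Qed.

Lemma is_derive_Rminus (f g : R -> R) (x a b : R) :
  is_derive f x a -> is_derive g x b -> is_derive (fun t => f t - g t) x (a - b).
Proof. exact (is_derive_minus f g x a b). Qed.

Lemma is_derive_Rmult (f g : R -> R) (x a b : R) :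
  is_derive f x a -> is_derive g x b -> is_derive (fun t => f t * g t) x (a * g x + f x * b).
Proof. intros hf hg. apply (is_derive_mult f g x a b hf hg). intros; apply Rmult_comm. Qed.

Lemma is_derive_Rid (x : R) : is_derive (fun t : R => t) x 1.
Proof. exact (is_derive_id x). Qed.

Lemma is_derive_Rconst (c x : R) : is_derive (fun _ : R => c) x 0.
Proof. exact (is_derive_const c x). Qed.

Lemma is_derive_Rcomp (f g : R -> R) (x a b : R) :
  is_derive f (g x) a -> is_derive g x b -> is_derive (fun t => f (g t)) x (a * b).
Proof.
  intros hf hg. apply is_derive_eq with (scal b a); [exact (is_derive_comp f g x a b hf hg) |].
  apply Rmult_comm.
Qed.

Lemma Derive_n_shift (D : R -> Prop) (f g : R -> R) :
  open D -> (forall x, D x -> is_derive f x (g x)) ->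
  forall n x, D x -> Derive_n f (S n) x = Derive_n g n x.
Proof.
  intros hD hfg n x hx.
  replace (S n) with (n + 1)%nat by lia. rewrite <- Derive_n_comp.
  apply Derive_n_ext_loc. apply filter_imp with D; [| now apply hD].
  intros t ht. now apply is_derive_unique, hfg.
Qed.

(** The derivatives are produced one at a time as functions of which only the
    values on [D] matter; closure under products and inverses is then a plain
    induction, without the higher Leibniz or quotient rules. *)
Fixpoint smooth_on (D : R -> Prop) (n : nat) (f : R -> R) : Prop :=
  match n with
  | O => True
  | S m => exists g, (forall x, D x -> is_derive f x (g x)) /\ smooth_on D m g
  end.

Lemma smooth_on_pred (D : R -> Prop) (n : nat) (f : R -> R) :
  smooth_on D (S n) f -> smooth_on D n f.
Proof.
  revert f; induction n as [| n IH]; intros f [g [hg hs]]; simpl; [exact I |].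
  exists g. split; [exact hg | now apply IH].
Qed.

Lemma smooth_on_plus (D : R -> Prop) (n : nat) (f g : R -> R) :
  smooth_on D n f -> smooth_on D n g -> smooth_on D n (fun x => f x + g x).
Proof.
  revert f g; induction n as [| n IH]; intros f g; simpl; [easy |].
  intros [f' [hf sf]] [g' [hg sg]]. exists (fun x => f' x + g' x). split.
  - intros x hx. apply is_derive_Rplus; auto.
  - now apply IH.
Qed.

Lemma smooth_on_mult (D : R -> Prop) (n : nat) (f g : R -> R) :
  smooth_on D n f -> smooth_on D n g -> smooth_on D n (fun x => f x * g x).
Proof.
  revert f g; induction n as [| n IH]; intros f g hf hg; [exact I |].
  pose proof (smooth_on_pred D n f hf) as hf0. pose proof (smooth_on_pred D n g hg) as hg0.
  destruct hf as [f' [hf sf]], hg as [g' [hg sg]].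
  exists (fun x => f' x * g x + f x * g' x). split.
  - intros x hx. apply is_derive_Rmult; auto.
  - apply smooth_on_plus; now apply IH.
Qed.

Lemma smooth_on_const (D : R -> Prop) (n : nat) (c : R) : smooth_on D n (fun _ => c).
Proof.
  revert c; induction n as [| n IH]; intros c; [exact I |].
  exists (fun _ => 0). split; [intros; apply is_derive_Rconst | apply IH].
Qed.

Lemma smooth_on_inv (D : R -> Prop) (n : nat) (f : R -> R) :
  (forall x, D x -> f x <> 0) -> smooth_on D n f -> smooth_on D n (fun x => / f x).
Proof.
  intros hnz. induction n as [| n IH]; intros hf; [exact I |].
  pose proof (IH (smooth_on_pred D n f hf)) as hi.
  destruct hf as [f' [hf sf]].
  exists (fun x => -1 * f' x * (/ f x * / f x)). split.
  - intros x hx. eapply is_derive_eq; [apply is_derive_inv; auto |].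
    field; auto.
  - apply (smooth_on_mult D n (fun x => -1 * f' x)); apply smooth_on_mult; auto.
    apply smooth_on_const.
Qed.

Lemma smooth_on_ex_derive_n (D : R -> Prop) (n : nat) (f : R -> R) (x : R) :
  open D -> smooth_on D n f -> D x -> ex_derive_n f n x.
Proof.
  intros hD. revert f x; induction n as [| n IH]; intros f x hf hx; [exact I |].
  destruct hf as [g [hg sg]]. destruct n as [| n].
  - exists (g x). now apply hg.
  - apply (ex_derive_ext_loc (Derive_n g n)); [| now apply (IH g)].
    apply filter_imp with D; [| now apply hD].
    intros t ht. symmetry. now apply Derive_n_shift with D.
Qed.

(** * Finite-order complete monotonicity *)

(** The sign is absorbed into the derivative: [- f'] is again of the same kind.
    This replaces binomial sums by one-step inductions.  The order is kept finite
    because the induction over the derivatives of a Riccati solution only knows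
    finitely many signs at each stage. *)
Fixpoint cm_upto (n : nat) (f : R -> R) : Prop :=
  match n with
  | O => forall x, 0 < x -> 0 <= f x
  | S m => (forall x, 0 < x -> 0 <= f x) /\
      exists g, (forall x, 0 < x -> is_derive f x (- g x)) /\ cm_upto m g
  end.

Lemma cm_upto_nonneg (n : nat) (f : R -> R) (x : R) : cm_upto n f -> 0 < x -> 0 <= f x.
Proof. destruct n as [| n]; [| intros [h _]; revert h]; intros h; apply h. Qed.

Lemma cm_upto_pred (n : nat) (f : R -> R) : cm_upto (S n) f -> cm_upto n f.
Proof.
  revert f; induction n as [| n IH]; intros f [h [g [hg hs]]]; [exact h |].
  split; [exact h |]. exists g. split; [exact hg | now apply IH].
Qed.

Lemma locally_pos (P : R -> Prop) (x : R) : 0 < x -> (forall t, 0 < t -> P t) -> locally x P.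
Proof. intros hx hP. apply filter_imp with (fun t => 0 < t); [exact hP | now apply open_gt]. Qed.

Lemma cm_upto_ext (n : nat) (f h : R -> R) :
  (forall x, 0 < x -> f x = h x) -> cm_upto n f -> cm_upto n h.
Proof.
  intros e. destruct n as [| n].
  - intros hf x hx. rewrite <- e by exact hx. now apply hf.
  - intros [hf [g [hg sg]]]. split.
    + intros x hx. rewrite <- e by exact hx. now apply hf.
    + exists g. split; [| exact sg]. intros x hx.
      apply (is_derive_ext_loc f); [| now apply hg]. now apply locally_pos.
Qed.

Lemma cm_upto_const (n : nat) (c : R) : 0 <= c -> cm_upto n (fun _ => c).
Proof.
  revert c; induction n as [| n IH]; intros c hc; [easy |].
  split; [easy |]. exists (fun _ => 0). split.
  - intros x _. eapply is_derive_eq; [apply is_derive_Rconst | ring].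
  - apply IH, Rle_refl.
Qed.

Lemma cm_upto_plus (n : nat) (f g : R -> R) :
  cm_upto n f -> cm_upto n g -> cm_upto n (fun x => f x + g x).
Proof.
  revert f g; induction n as [| n IH]; intros f g.
  - intros hf hg x hx. apply Rplus_le_le_0_compat; auto.
  - intros [hf [f' [df sf]]] [hg [g' [dg sg]]]. split.
    + intros x hx. apply Rplus_le_le_0_compat; auto.
    + exists (fun x => f' x + g' x). split; [| now apply IH].
      intros x hx. eapply is_derive_eq; [apply is_derive_Rplus; auto | ring].
Qed.

Lemma cm_upto_mult (n : nat) (f g : R -> R) :
  cm_upto n f -> cm_upto n g -> cm_upto n (fun x => f x * g x).
Proof.
  revert f g; induction n as [| n IH]; intros f g hf hg.
  - intros x hx. apply Rmult_le_pos; auto.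
  - pose proof (cm_upto_pred n f hf) as hf0. pose proof (cm_upto_pred n g hg) as hg0.
    destruct hf as [hf [f' [df sf]]], hg as [hg [g' [dg sg]]]. split.
    + intros x hx. apply Rmult_le_pos; auto.
    + exists (fun x => f' x * g x + f x * g' x). split.
      * intros x hx. eapply is_derive_eq; [apply is_derive_Rmult; auto | ring].
      * apply cm_upto_plus; now apply IH.
Qed.

(** [- (f o p)'] is [(- f' o p) * p'], where [- f'] has one order less than [f].
    The hypotheses on [p] and [q] are those of a positive Bernstein function [p]
    with derivative [q], to order [n]. *)
Lemma cm_upto_comp (n : nat) (f p q : R -> R) :
  (forall x, 0 < x -> 0 < p x) -> (forall x, 0 < x -> is_derive p x (q x)) ->
  cm_upto n q -> cm_upto n f -> cm_upto n (fun x => f (p x)).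
Proof.
  intros hp hpq. revert f; induction n as [| n IH]; intros f hq hf.
  - intros x hx. apply hf, hp, hx.
  - destruct hf as [hf [f' [df sf]]]. split; [intros x hx; apply hf, hp, hx |].
    apply cm_upto_pred in hq.
    exists (fun x => f' (p x) * q x). split.
    + intros x hx. eapply is_derive_eq; [apply is_derive_Rcomp; auto | ring].
    + apply cm_upto_mult; [now apply IH | exact hq].
Qed.

Lemma cm_upto_Rpower (n : nat) (p : R) : p <= 0 -> cm_upto n (fun x => Rpower x p).
Proof.
  revert p; induction n as [| n IH]; intros p hp.
  - intros x _. apply Rlt_le, Rpower_pos.
  - split; [intros x _; apply Rlt_le, Rpower_pos |].
    exists (fun x => - p * Rpower x (p - 1)). split.
    + intros x hx. eapply is_derive_eq; [now apply is_derive_Rpower | ring].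
    + apply (cm_upto_mult n (fun _ => - p)); [apply cm_upto_const | apply IH]; lra.
Qed.

Lemma cm_upto_smooth_on (n : nat) (f : R -> R) : cm_upto n f -> smooth_on (Rlt 0) n f.
Proof.
  revert f; induction n as [| n IH]; intros f; [easy |].
  intros [_ [g [hg sg]]]. exists (fun x => -1 * g x). split.
  - intros x hx. eapply is_derive_eq; [now apply hg | ring].
  - apply (smooth_on_mult _ n (fun _ => -1)); [apply smooth_on_const | now apply IH].
Qed.

Lemma cm_upto_Derive_n_sign (n : nat) (f : R -> R) (x : R) :
  cm_upto n f -> 0 < x -> 0 <= (-1) ^ n * Derive_n f n x.
Proof.
  revert f; induction n as [| n IH]; intros f hf hx.
  - simpl. rewrite Rmult_1_l. now apply hf.
  - destruct hf as [_ [g [hg sg]]].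
    rewrite (Derive_n_shift (Rlt 0) f (fun t => - g t) (open_gt 0) hg n x hx), Derive_n_opp.
    replace ((-1) ^ S n * - Derive_n g n x) with ((-1) ^ n * Derive_n g n x) by (simpl; ring).
    now apply IH.
Qed.

Lemma completely_monotone_of_cm_upto (f : R -> R) :
  (forall n, cm_upto n f) -> completely_monotone f.
Proof.
  intros hf. split; intros n x hx.
  - apply (smooth_on_ex_derive_n (Rlt 0)); [apply open_gt | now apply cm_upto_smooth_on | exact hx].
  - now apply cm_upto_Derive_n_sign.
Qed.

Lemma bernstein_of_cm_derivative (f h : R -> R) :
  (forall x, 0 < x -> 0 <= f x) -> (forall x, 0 < x -> is_derive f x (h x)) ->
  (forall n, cm_upto n h) -> bernstein f.
Proof.
  intros hf hd hh. split; [exact hf | split].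
  - intros [| n] x hx; [exact I |].
    apply (smooth_on_ex_derive_n (Rlt 0)); [apply open_gt | | exact hx].
    exists h. split; [exact hd | apply cm_upto_smooth_on, hh].
  - apply completely_monotone_of_cm_upto. intros n. apply (cm_upto_ext n h); [| apply hh].
    intros x hx. symmetry. now apply is_derive_unique, hd.
Qed.

(** Turns the signs of finitely many members of a chain of derivatives into
    complete monotonicity of each member, to the order which the known signs allow. *)
Lemma cm_upto_of_signs (F : nat -> R -> R) (N : nat) :
  (forall k x, 0 < x -> is_derive (F k) x (F (S k) x)) ->
  (forall k x, (k < N)%nat -> 0 < x -> 0 <= (-1) ^ k * F k x) ->
  forall m k, (k + m < N)%nat -> cm_upto m (fun x => (-1) ^ k * F k x).
Proof.
  intros hd hs. induction m as [| m IH]; intros k hk.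
  - intros x hx. apply hs; [lia | exact hx].
  - split; [intros x hx; apply hs; [lia | exact hx] |].
    exists (fun x => (-1) ^ S k * F (S k) x). split; [| apply IH; lia].
    intros x hx. eapply is_derive_eq; [apply is_derive_scal, hd, hx | simpl; ring].
Qed.

(** * Solutions of a Riccati equation *)

Lemma nonneg_at_0 (f : R -> R) :
  continuous f 0 -> (forall x, 0 < x -> 0 <= f x) -> 0 <= f 0.
Proof.
  intros hc hf. apply Rnot_lt_le. intros hneg.
  assert (hl : locally 0 (fun t => f t < 0)).
  { apply (hc (fun u => u < 0)). now apply open_lt. }
  destruct hl as [d hd]. pose proof (cond_pos d).
  specialize (hf (d / 2) ltac:(lra)).
  assert (hb : f (d / 2) < 0).
  { apply hd. unfold ball; simpl. unfold AbsRing_ball, abs, minus, plus, opp; simpl.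
    apply Rabs_def1; lra. }
  lra.
Qed.

(** At a minimum of [Z] over the segment from [0] to [y] the derivative cannot be positive, unless the
    minimum is at [0]; the hypothesis excludes both at a negative value. *)
Lemma nonneg_of_minimum (Z Z' : R -> R) :
  (forall y, 0 <= y -> is_derive Z y (Z' y)) ->
  (forall y, 0 <= y -> Z y < 0 -> 0 < y /\ 0 < Z' y) ->
  forall y, 0 <= y -> 0 <= Z y.
Proof.
  intros hd hneg y0 hy0. apply Rnot_lt_le. intros hlt.
  destruct (continuity_ab_min Z 0 y0 hy0) as [y [hmin hy]].
  { intros c hc. apply continuity_pt_filterlim, (ex_derive_continuous Z).
    exists (Z' c). apply hd. lra. }
  pose proof (hmin y0 ltac:(lra)).
  destruct (hneg y ltac:(lra) ltac:(lra)) as [hy1 hpos].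
  assert (hl := proj1 (is_derive_Reals Z y (Z' y)) (hd y ltac:(lra)) (Z' y) hpos).
  destruct hl as [d hl]. pose proof (cond_pos d).
  set (h := - Rmin (d / 2) y).
  assert (hh : h < 0 /\ - h <= d / 2 /\ 0 <= y + h).
  { unfold h. pose proof (Rmin_l (d / 2) y). pose proof (Rmin_r (d / 2) y).
    pose proof (Rmin_glb_lt (d / 2) y 0 ltac:(lra) hy1). lra. }
  specialize (hl h ltac:(lra)).
  rewrite Rabs_left in hl by lra. specialize (hl ltac:(lra)).
  apply Rabs_def2 in hl.
  assert (hq : 0 < (Z (y + h) - Z y) / h) by lra.
  pose proof (hmin (y + h) ltac:(lra)) as hm.
  assert (hprod : (Z (y + h) - Z y) / h * h = Z (y + h) - Z y) by (field; lra).
  pose proof (Rmult_lt_0_compat _ (- h) hq ltac:(lra)). lra.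
Qed.

(** [U k] is the [k]-th derivative of a solution [U 0].  The domain [D] is an open
    neighbourhood of the closed half-line, so that the equation can be
    differentiated at [0] as well. *)
Section RiccatiDerivatives.

Variables (m : R) (D : R -> Prop) (U : nat -> R -> R).
Hypothesis m_pos : 0 < m.
Hypothesis D_open : open D.
Hypothesis D_nonneg : forall y, 0 <= y -> D y.
Hypothesis U_chain : forall k y, D y -> is_derive (U k) y (U (S k) y).
Hypothesis riccati : forall y, D y -> y * U 1 y = m * U 0 y + y - U 0 y * U 0 y.
Hypothesis U_ge : forall y, 0 <= y -> m <= U 0 y.

(** The inhomogeneous term of the linear equation
    [y v' = (m - 1 - k - 2 U_0) v + S_k] satisfied by [v = U_(k + 1)].  Reading
    [S_k] off from this equation, rather than writing it as a Leibniz sum, makes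
    the recursion [S_(k + 1) = S_k' - 2 U_1 U_(k + 1)] a ring identity. *)
Definition riccati_source (k : nat) (y : R) : R :=
  y * U (S (S k)) y - (m - 1 - INR k - 2 * U 0 y) * U (S k) y.

Lemma is_derive_riccati_source (k : nat) (y : R) : D y ->
  is_derive (riccati_source k) y (riccati_source (S k) y + 2 * (U 1 y * U (S k) y)).
Proof.
  intros hy. unfold riccati_source. eapply is_derive_eq.
  - apply is_derive_Rminus; apply is_derive_Rmult.
    + apply is_derive_Rid.
    + now apply U_chain.
    + apply is_derive_Rminus; [apply is_derive_Rconst | apply is_derive_scal; now apply U_chain].
    + now apply U_chain.
  - rewrite S_INR. ring.
Qed.

(** The derivative of the Riccati equation itself. *)
Lemma riccati_source_0 (y : R) : D y -> riccati_source 0 y = 1.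
Proof.
  intros hy.
  set (T := fun y => y * U 1 y - (m * U 0 y + y - U 0 y * U 0 y)).
  assert (h0 : Derive T y = 0).
  { rewrite (Derive_ext_loc T (fun _ => 0)); [apply Derive_const |].
    apply filter_imp with D; [| now apply D_open].
    intros t ht. unfold T. rewrite (riccati t ht). ring. }
  assert (hT : is_derive T y (1 * U 1 y + y * U 2 y - (m * U 1 y + 1 - (U 1 y * U 0 y + U 0 y * U 1 y)))).
  { unfold T. apply is_derive_Rminus.
    - apply is_derive_Rmult; [apply is_derive_Rid | now apply U_chain].
    - apply is_derive_Rminus; [apply is_derive_Rplus |].
      + now apply is_derive_scal, U_chain.
      + apply is_derive_Rid.
      + apply is_derive_Rmult; now apply U_chain. }
  apply is_derive_unique in hT. unfold riccati_source. simpl INR. lra.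
Qed.

(** Induction on [k] through the recursion
    [(-1) ^ (k + 1) S_(k + 1) = - ((-1) ^ k S_k)' + 2 U_1 * ((-1) ^ k U_(k + 1))]:
    each step costs one order, and the right-hand side is a sum of functions that
    are completely monotone to the remaining order. At [k = n] only the sign of
    [(-1) ^ n S_n] is left, which is what is needed. *)
Lemma riccati_source_cm (n : nat) :
  (forall k y, (k < n)%nat -> 0 <= y -> 0 <= (-1) ^ k * U (S k) y) ->
  forall k, (k <= n)%nat -> cm_upto (n - k) (fun y => (-1) ^ k * riccati_source k y).
Proof.
  intros hs.
  assert (hcm := cm_upto_of_signs (fun k => U (S k)) n
    (fun k x hx => U_chain (S k) x (D_nonneg x (Rlt_le _ _ hx)))
    (fun k x hk hx => hs k x hk (Rlt_le _ _ hx))).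
  induction k as [| k IH]; intros hk.
  - apply (cm_upto_ext _ (fun _ => 1)); [| apply cm_upto_const; lra].
    intros y hy. rewrite riccati_source_0 by (apply D_nonneg; lra). simpl; ring.
  - specialize (IH ltac:(lia)). replace (n - k)%nat with (S (n - S k)) in IH by lia.
    destruct IH as [_ [g [hg sg]]].
    apply (cm_upto_ext _ (fun y => g y + 2 * (((-1) ^ 0 * U 1 y) * ((-1) ^ k * U (S k) y)))).
    + intros y hy. pose proof (D_nonneg y (Rlt_le _ _ hy)) as hDy.
      pose proof (is_derive_unique _ _ _ (hg y hy)) as e1.
      pose proof (is_derive_unique _ _ _
        (is_derive_scal _ _ ((-1) ^ k) _ (is_derive_riccati_source k y hDy))) as e2.
      rewrite e1 in e2. simpl pow. lra.
    + apply cm_upto_plus; [exact sg |].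
      apply (cm_upto_mult _ (fun _ => 2)); [apply cm_upto_const; lra |].
      apply cm_upto_mult; apply hcm; lia.
Qed.

(** The derivative of a Riccati solution bounded below by [m] is completely
    monotone, by strong induction: at a negative value of
    [Z = (-1) ^ n * U (n + 1)] the linear equation forces [y Z' > 0]. *)
Lemma riccati_derivative_signs (n : nat) (y : R) : 0 <= y -> 0 <= (-1) ^ n * U (S n) y.
Proof.
  revert y. induction n as [n IH] using (well_founded_ind Nat.lt_wf_0).
  assert (hS : forall y, 0 <= y -> 0 <= (-1) ^ n * riccati_source n y).
  { assert (hpos : forall y, 0 < y -> 0 <= (-1) ^ n * riccati_source n y).
    { intros y hy. apply (cm_upto_nonneg (n - n) (fun y => (-1) ^ n * riccati_source n y)); [| exact hy].
      apply riccati_source_cm; [| lia]. intros k z hk hz. now apply IH. }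
    intros y [hy | <-]; [now apply hpos |].
    (* Signs were propagated on the open half-line; [0] is reached by continuity. *)
    apply (nonneg_at_0 (fun y => (-1) ^ n * riccati_source n y)); [| exact hpos].
    apply (ex_derive_continuous (fun y => (-1) ^ n * riccati_source n y)).
    eexists. apply is_derive_scal, is_derive_riccati_source, D_nonneg, Rle_refl. }
  apply (nonneg_of_minimum _ (fun y => (-1) ^ n * U (S (S n)) y)).
  - intros y hy. now apply is_derive_scal, U_chain, D_nonneg.
  - intros y hy hneg. specialize (hS y hy). specialize (U_ge y hy).
    pose proof (pos_INR n) as hn.
    set (Z := (-1) ^ n * U (S n) y) in *. set (Z' := (-1) ^ n * U (S (S n)) y).
    (* Splitting off [U 0 y - m] shows that the coefficient of [Z] is negative. *)
    assert (e : y * Z' = (-1) ^ n * riccati_source n y + (m + 1 + INR n + 2 * (U 0 y - m)) * - Z).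
    { unfold Z', Z, riccati_source. ring. }
    assert (hprod : 0 < (m + 1 + INR n + 2 * (U 0 y - m)) * - Z)
      by (apply Rmult_lt_0_compat; lra).
    destruct hy as [hy | <-]; [| lra].
    split; [exact hy |]. apply Rmult_lt_reg_l with y; lra.
Qed.

End RiccatiDerivatives.

(** * The Bessel quotient *)

Definition bessel_ratio (nu y : R) : R := bessel_series nu y / bessel_series (nu + 1) y.

Lemma bessel_series_smooth (D : R -> Prop) (n : nat) (mu : R) :
  -1 < mu -> smooth_on D n (bessel_series mu).
Proof.
  revert mu; induction n as [| n IH]; intros mu hmu; [exact I |].
  exists (bessel_series (mu + 1)). split; [| apply IH; lra].
  intros y _. now apply is_derive_bessel_series.
Qed.

Lemma bessel_ratio_ge (nu y : R) : -1 < nu -> 0 <= y -> nu + 1 <= bessel_ratio nu y.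
Proof.
  intros hnu hy. unfold bessel_ratio. rewrite (bessel_series_contiguous nu y hnu).
  pose proof (bessel_series_pos (nu + 1) y ltac:(lra) hy) as hB.
  pose proof (bessel_series_pos (nu + 1 + 1) y ltac:(lra) hy) as hC.
  replace (((nu + 1) * bessel_series (nu + 1) y + y * bessel_series (nu + 1 + 1) y)
    / bessel_series (nu + 1) y) with
    (nu + 1 + y * (bessel_series (nu + 1 + 1) y / bessel_series (nu + 1) y)) by (field; lra).
  pose proof (Rmult_le_pos _ _ hy (Rlt_le _ _ (Rdiv_lt_0_compat _ _ hC hB))). lra.
Qed.

Lemma bessel_ratio_riccati (nu y : R) : -1 < nu -> bessel_series (nu + 1) y <> 0 ->
  exists u', is_derive (bessel_ratio nu) y u' /\
    y * u' = (nu + 1) * bessel_ratio nu y + y - bessel_ratio nu y * bessel_ratio nu y.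
Proof.
  intros hnu hnz. eexists. split.
  - unfold bessel_ratio. apply is_derive_div; [| | exact hnz].
    + now apply is_derive_bessel_series.
    + apply is_derive_bessel_series; lra.
  - pose proof (bessel_series_contiguous nu y hnu) as e.
    unfold bessel_ratio, Rdiv. rewrite e. field. exact hnz.
Qed.

Lemma bessel_ratio_derivatives (nu : R) : -1 < nu ->
  exists h, (forall y, 0 < y -> is_derive (bessel_ratio nu) y (h y)) /\ forall n, cm_upto n h.
Proof.
  intros hnu.
  (* An open set around the closed half-line on which the quotient is smooth. *)
  set (D := fun y => 0 < bessel_series (nu + 1) y).
  assert (hDo : open D).
  { apply (open_comp (bessel_series (nu + 1)) (fun u => 0 < u)); [| apply open_gt].
    intros y _. apply (ex_derive_continuous (bessel_series (nu + 1))).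
    eexists. apply is_derive_bessel_series. lra. }
  assert (hDp : forall y, 0 <= y -> D y) by (intros y hy; apply bessel_series_pos; lra).
  set (U := Derive_n (bessel_ratio nu)).
  assert (hU : forall k y, D y -> is_derive (U k) y (U (S k) y)).
  { intros k y hy. apply Derive_correct.
    apply (smooth_on_ex_derive_n D (S k)); [exact hDo | | exact hy].
    apply smooth_on_mult; [now apply bessel_series_smooth |].
    apply smooth_on_inv; [| apply bessel_series_smooth; lra].
    intros z hz. apply Rgt_not_eq, hz. }
  assert (hs := riccati_derivative_signs (nu + 1) D U ltac:(lra) hDo hDp hU).
  exists (U 1%nat). split.
  - intros y hy. apply (hU 0%nat), hDp; lra.
  - intros n. apply (cm_upto_ext n (fun y => (-1) ^ 0 * U 1%nat y)); [intros; simpl; ring |].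
    apply (cm_upto_of_signs (fun k => U (S k)) (S n)); [| | lia].
    + intros k y hy. apply hU, hDp; lra.
    + intros k y _ hy. apply hs; [| | lra].
      * intros z hz. destruct (bessel_ratio_riccati nu z hnu ltac:(now apply Rgt_not_eq)) as [u' [hu e]].
        apply is_derive_unique in hu.
        change (U 1%nat z) with (Derive (bessel_ratio nu) z). now rewrite hu.
      * intros z hz. now apply bessel_ratio_ge.
Qed.

Theorem theorem3p2 (nu tau : R) (hnu : -1 < nu) (htau0 : 0 < tau) (htau : tau <= 1 / 2) :
  bernstein (fun x : R => W nu (Rpower x tau)).
Proof.
  destruct (bessel_ratio_derivatives nu hnu) as [h [hd hcm]].
  set (p := fun x => / 4 * Rpower x (2 * tau)).
  set (q := fun x => / 4 * (2 * tau * Rpower x (2 * tau - 1))).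
  assert (hp : forall x, 0 < p x).
  { intros x. pose proof (Rpower_pos x (2 * tau)). unfold p. lra. }
  assert (hpq : forall x, 0 < x -> is_derive p x (q x)).
  { intros x hx. now apply is_derive_scal, is_derive_Rpower. }
  assert (hq : forall n, cm_upto n q).
  { intros n. apply (cm_upto_mult n (fun _ => / 4)); [apply cm_upto_const; lra |].
    apply (cm_upto_mult n (fun _ => 2 * tau)); [apply cm_upto_const; lra |].
    apply cm_upto_Rpower. lra. }
  assert (hW : forall x, 2 * bessel_ratio nu (p x) = W nu (Rpower x tau)).
  { intros x. rewrite W_eq_ratio by (exact hnu || apply Rpower_pos).
    replace (Rpower x tau ^ 2 / 4) with (p x); [reflexivity |].
    unfold p. replace (2 * tau) with (tau + tau) by ring. rewrite Rpower_plus. field. }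
  apply bernstein_of_cm_derivative with (fun x => 2 * (h (p x) * q x)).
  - intros x _. rewrite <- hW.
    pose proof (bessel_ratio_ge nu (p x) hnu (Rlt_le _ _ (hp x))). lra.
  - intros x hx. apply (is_derive_ext _ _ _ _ hW).
    apply is_derive_scal, is_derive_Rcomp; [apply hd, hp | now apply hpq].
  - intros n. apply (cm_upto_mult n (fun _ => 2)); [apply cm_upto_const; lra |].
    apply cm_upto_mult; [| apply hq].
    apply (cm_upto_comp n h p q); auto.
Qed.
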